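(* Let $G$ be a connected graph and $v\in V(G)$. Then $$\chi_d^t(G)-\deg(v)+1\leq \chi_d^t(G\odot v)\leq \chi_d^t(G)+1.$$
   Context: All graphs are simple and finite. For a graph with no isolated vertex, a total dominator coloring (TD-coloring) is a proper vertex coloring in which every vertex is adjacent to every vertex of some color class (a class other than its own); $\chi_d^t$ denotes the minimum number of colors in such a coloring. $G\odot v$ denotes the graph obtained from $G$ by removing all edges between pairs of neighbours of $v$ (the vertex $v$ itself is not removed). Implicitly, every graph whose $\chi_d^t$ appears has no isolated vertex. *)

(* Defs.v *)
From mathcomp Require Import all_boot.
Set Implicit Arguments.
Unset Strict Implicit.
Unset Printing Implicit Defensive.

Record sgraph := SGraph {
  vertex :> finType;
  adj : rel vertex;
  adj_sym : symmetric adj;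
  adj_irrefl : irreflexive adj
}.
Arguments adj {s}.

Definition neighbors (G : sgraph) (v : G) : {set G} := [set x | adj v x].

Definition degree (G : sgraph) (v : G) : nat := #|neighbors v|.

Definition no_isolated (G : sgraph) : Prop := forall x : G, exists y : G, adj x y.

Definition connected_graph (G : sgraph) : Prop :=
  forall x y : G, connect adj x y.

Definition proper_coloring (G : sgraph) (C : eqType) (c : G -> C) : bool :=
  [forall x, forall y, adj x y ==> (c x != c y)].

(* A color class is given by one of its members z, so only nonempty classes
   count. *)
Definition td_coloring (G : sgraph) (C : eqType) (c : G -> C) : bool :=
  proper_coloring c &&
  [forall x, exists z : G,
     (c z != c x) && [forall y : G, (c y == c z) ==> adj x y]].

Definition ncolors (G : sgraph) (C : finType) (c : G -> C) : nat :=
  #|[set c x | x : G]|.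

(* A palette of #|G| colors loses no generality, by td_chromatic_le. When G has
   no isolated vertex the minimum is over a nonempty family (td_chromatic_attained);
   otherwise there is no TD-coloring and the value #|G| is a junk value. *)
Definition td_chromatic (G : sgraph) : nat :=
  \big[minn/#|G|]_(c : {ffun G -> 'I_#|G|} | td_coloring c) ncolors c.

Section Odot.
Variables (G : sgraph) (v : G).

Definition odot_adj : rel G :=
  fun x y => adj x y && ~~ ((x \in neighbors v) && (y \in neighbors v)).

Lemma odot_adj_sym : symmetric odot_adj.
Proof. by move=> x y; rewrite /odot_adj adj_sym andbC [X in ~~ X]andbC andbC. Qed.

Lemma odot_adj_irrefl : irreflexive odot_adj.
Proof. by move=> x; rewrite /odot_adj adj_irrefl. Qed.

Definition odot : sgraph := SGraph odot_adj_sym odot_adj_irrefl.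

Lemma odot_no_isolated : no_isolated G -> no_isolated odot.
Proof.
move=> Giso x; case: (boolP (adj v x)) => [vx | nvx].
  exists v; rewrite /= /odot_adj adj_sym vx /= !inE adj_irrefl andbF //.
by have [y xy] := Giso x; exists y; rewrite /= /odot_adj xy !inE (negPf nvx).
Qed.

End Odot.

Section Spec.
Variable G : sgraph.

Lemma td_coloring_inj (C D : eqType) (c : G -> C) (d : G -> D) :
  (forall x y, (d x == d y) = (c x == c y)) -> td_coloring d = td_coloring c.
Proof.
move=> dc; rewrite /td_coloring /proper_coloring; congr (_ && _).
  by apply: eq_forallb => x; apply: eq_forallb => y; rewrite dc.
apply: eq_forallb => x; apply: eq_existsb => z; rewrite dc; congr (_ && _).
by apply: eq_forallb => y; rewrite dc.
Qed.

Lemma td_chromatic_le (C : finType) (c : G -> C) :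
  td_coloring c -> td_chromatic G <= ncolors c.
Proof.
move=> tdc.
pose r x := odflt x [pick z | c z == c x].
have cr x : c (r x) = c x.
  by rewrite /r; case: pickP => [z /eqP|] //=.
pose d := [ffun x => enum_rank (r x)] : {ffun G -> 'I_#|G|}.
have dc x y : (d x == d y) = (c x == c y).
  rewrite !ffunE (inj_eq enum_rank_inj); apply/eqP/eqP => [e|e].
    by rewrite -cr e cr.
  rewrite /r e; case: pickP => //= /(_ y); by rewrite eqxx.
have nd : ncolors d = ncolors c.
  have -> : ncolors c = #|[set c (enum_val i) | i in [set d x | x : G]]|.
    rewrite /ncolors -imset_comp; congr #|pred_of_set _|; apply: eq_imset => x /=.
    by rewrite ffunE enum_rankK cr.
  rewrite card_in_imset // => _ _ /imsetP[x _ ->] /imsetP[y _ ->].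
  by rewrite !ffunE !enum_rankK !cr => /eqP; rewrite -dc !ffunE => /eqP.
rewrite -nd /td_chromatic; have: d \in index_enum _ by rewrite mem_index_enum.
have: td_coloring d by rewrite (td_coloring_inj dc).
move=> tdd; elim: (index_enum _) => // e s IHs; rewrite big_cons inE.
case: eqP => [<- _ | _ /= /IHs le_s]; first by rewrite tdd geq_minl.
by case: ifP => // _; apply: leq_trans le_s; apply: geq_minr.
Qed.

Lemma td_chromatic_attained : no_isolated G ->
  exists2 c : {ffun G -> 'I_#|G|}, td_coloring c & ncolors c = td_chromatic G.
Proof.
move=> Giso; rewrite /td_chromatic.
apply: (big_ind (fun k =>
  exists2 c : {ffun G -> 'I_#|G|}, td_coloring c & ncolors c = k)).
- exists [ffun x => enum_rank x]; last first.
    by rewrite /ncolors card_imset ?cardsT // => x y; rewrite !ffunE => /enum_rank_inj.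
  rewrite (@td_coloring_inj G _ id); last first.
    by move=> x y; rewrite !ffunE (inj_eq enum_rank_inj).
  apply/andP; split.
    apply/forallP => x; apply/forallP => y; apply/implyP => xy.
    by apply: contraTneq xy => ->; rewrite adj_irrefl.
  apply/forallP => x; have [z xz] := Giso x; apply/existsP; exists z.
  apply/andP; split; first by apply: contraTneq xz => ->; rewrite adj_irrefl.
  by apply/forallP => y; apply/implyP => /eqP ->.
- by move=> m n hm hn; rewrite /minn; case: ifP.
- by move=> c tdc; exists c.
Qed.

End Spec.

(* Main.v *)
Require Import Defs.
From mathcomp Require Import all_boot all_order all_algebra.
From mathcomp Require Import zify.
Set Implicit Arguments.
Unset Strict Implicit.
Unset Printing Implicit Defensive.
Import Order.TTheory GRing.Theory Num.Theory.
Local Open Scope ring_scope.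

(** Giving each vertex of a set S its own fresh color never destroys domination:
    what is left of a dominated class is still dominated if nonempty, and
    otherwise the class lies in S and any of its members is now a dominated
    singleton class. For the upper bound take S = {v}: {v} serves all the
    neighbors of v, and the other vertices have the same neighbors in both
    graphs. For the lower bound take S to be all neighbors of v but one: every
    edge of G missing from the odot graph has an end in S. *)

(** The sum type keeps the fresh colors apart from the old ones. *)
Definition recolor (T : finType) (C : eqType) (S : {set T}) (c : T -> C) (x : T) :
    C + T :=
  if x \in S then inr x else inl (c x).

(** [A] will be the neighborhood of a vertex, in [G] or in [odot v]; the witness [z] makes the class
    nonempty. *)
Definition contains_class (T : finType) (C : eqType) (c : T -> C) (A : pred T) :=
  exists z, forall y, c y = c z -> A y.

Lemma td_coloringP (G : sgraph) (C : eqType) (c : G -> C) :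
  reflect ((forall x y, adj x y -> c x <> c y) /\
           forall x, contains_class c (adj x)) (td_coloring c).
Proof.
apply: (iffP andP) => -[Hp Hd]; split.
- by move=> x y xy; apply/eqP; move/forallP/(_ x)/forallP/(_ y)/implyP: Hp; apply.
- move=> x; move/forallP/(_ x)/existsP: Hd => [z /andP[_ /forallP Hz]].
  by exists z => y /eqP; apply/implyP.
- by apply/forallP => x; apply/forallP => y; apply/implyP => /Hp/eqP.
- apply/forallP => x; have [z Hz] := Hd x; apply/existsP; exists z.
  apply/andP; split; last by apply/forallP => y; apply/implyP => /eqP/Hz.
  (* If [z] had the color of [x], then [x] would lie in the class it dominates and be adjacent to
     itself. *)
  by apply/eqP => /esym/Hz; rewrite adj_irrefl.
Qed.

Section Recolor.
Variables (T : finType) (S : {set T}).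

Lemma recolor_eq (C : eqType) (c : T -> C) x y :
  recolor S c x = recolor S c y -> c x = c y.
Proof. by rewrite /recolor; do 2![case: ifP => _] => // -[->]. Qed.

Lemma recolor_eq_in (C : eqType) (c : T -> C) x y :
  x \in S -> recolor S c y = recolor S c x -> y = x.
Proof. by rewrite /recolor => ->; case: ifP => // _ [->]. Qed.

(** Recoloring refines the partition into color classes, so the new class of the witness [z] lies
    inside its old class. *)
Lemma contains_class_recolor (C : eqType) (c : T -> C) (A : pred T) :
  contains_class c A -> contains_class (recolor S c) A.
Proof. by case=> z Hz; exists z => y /recolor_eq/Hz. Qed.

Lemma card_recolor (C : finType) (c : T -> C) :
  (#|[set recolor S c x | x : T]| <= #|[set c x | x : T]| + #|S|)%N.
Proof.
pose L : {set C + T} := inl @: [set c x | x : T].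
pose R : {set C + T} := inr @: S.
have sub : [set recolor S c x | x : T] \subset L :|: R.
  apply/subsetP => _ /imsetP[x _ ->]; rewrite inE /recolor.
  by case: ifP => xS; rewrite !imset_f ?orbT.
apply: leq_trans (subset_leq_card sub) _.
apply: leq_trans (leq_card_setU _ _) _.
by rewrite leq_add ?leq_imset_card.
Qed.

End Recolor.

Lemma td_chromatic_odot_le (G : sgraph) (v : G) :
  no_isolated G -> (td_chromatic (odot v) <= (td_chromatic G).+1)%N.
Proof.
move=> Giso; have [c /td_coloringP[cp cd] <-] := td_chromatic_attained Giso.
have td : @td_coloring (odot v) _ (recolor [set v] c).
  apply/td_coloringP; split=> [x y /andP[xy _] /recolor_eq|x]; first exact: cp.
  case: (boolP (adj v x)) => vx.
    exists v => y /recolor_eq_in ->; rewrite ?set11 //=.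
    (* The edge from [x] to [v] survives because [v] is not its own neighbor. *)
    by rewrite /odot_adj adj_sym vx !inE adj_irrefl andbF.
  have [z Hz] := contains_class_recolor [set v] (cd x).
  by exists z => y /Hz xy; rewrite /= /odot_adj xy !inE (negPf vx).
apply: leq_trans (td_chromatic_le td) _.
by rewrite -addn1 -(cards1 v); apply: card_recolor.
Qed.

Lemma td_chromatic_le_odot (G : sgraph) (v : G) :
  no_isolated G ->
  (td_chromatic G < td_chromatic (odot v) + degree v)%N.
Proof.
move=> Giso; have [w vw] := Giso v.
have wN : w \in neighbors v by rewrite inE.
have [c /td_coloringP[cp cd] <-] := td_chromatic_attained (odot_no_isolated (v := v) Giso).
(* Sparing [w] saves one color, whence the strict inequality. *)
pose S := neighbors v :\ w.
have td : @td_coloring G _ (recolor S c).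
  apply/td_coloringP; split=> [x y xy e|x]; last first.
    (* Domination passes to [G] since every edge of [odot v] is an edge of [G]. *)
    have [z Hz] := contains_class_recolor S (cd x).
    by exists z => y /Hz/andP[].
  have xNy : x != y by apply: contraTneq xy => ->; rewrite adj_irrefl.
  have [xS|xS] := boolP (x \in S).
    by rewrite (recolor_eq_in xS (esym e)) eqxx in xNy.
  have [yS|yS] := boolP (y \in S).
    by rewrite (recolor_eq_in yS e) eqxx in xNy.
  (* An edge of [G] lost in [odot v] joins two neighbors of [v]; outside [S] both would be [w]. *)
  apply: (cp x y) (recolor_eq e); rewrite /= /odot_adj xy /=.
  apply/negP => /andP[xN yN]; move: xS yS xNy.
  by rewrite /S !in_setD1 xN yN !andbT !negbK => /eqP -> /eqP ->; rewrite eqxx.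
rewrite /degree (cardsD1 w) wN addnCA add1n ltnS.
apply: leq_trans (td_chromatic_le td) _.
exact: (card_recolor S c).
Qed.

Theorem theorem3p5 (G : sgraph) (v : G)
    (Gconn : connected_graph G) (Giso : no_isolated G) :
  (td_chromatic G)%:Z - (degree v)%:Z + 1 <= (td_chromatic (odot v))%:Z
  /\ (td_chromatic (odot v))%:Z <= (td_chromatic G)%:Z + 1.
Proof.
have := td_chromatic_odot_le v Giso.
(* Over the integers the strict bound is the one with [+ 1]. *)
by have := td_chromatic_le_odot v Giso; lia.
Qed.
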